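(* Let $0<d<r$ be constants, let $D'=\{\mathbf x\in\mathbb{R}^n:d<|\mathbf x|<r\}$ and $Y''=\{\mathbf y\in\mathbb{R}^n:r<|\mathbf y|<2r\}$. Let $R$ be the spherical Radon transform $Rf(\mathbf y)=\int_{S(\mathbf y)}f\,dS$, $S(\mathbf y)=\{\mathbf x\in\mathbb{R}^n:|\mathbf x-\mathbf y|=r\}$, with constant radius $r$. Let $f$ be a distribution supported in $D'$ and let $Rf(\mathbf y)$ be known for $\mathbf y\in Y''$. Then the reconstruction of $f$ from $Rf$ is weakly stable everywhere in $D'$; that is, $R:\mathcal E'(D')\to\mathcal D'(Y'')$ is weakly stable.
   Context: $dS$ is surface measure; $\mathcal E'$ and $\mathcal D'$ denote compactly supported distributions and distributions, respectively. For a smooth radius function $r(\mathbf y)>0$ with $|\nabla r|<1$ and $\mathbf x\in S(\mathbf y)$, the artifact point $\hat{\mathbf x}(\mathbf y,\mathbf x)$ is the second point of intersection (besides $\mathbf x$) of $S(\mathbf y)$ with the line through $\mathbf x$ and $\mathbf y-r(\mathbf y)\nabla r(\mathbf y)$; for constant $r$ it is the antipodal point $\mathbf x-2(\mathbf x-\mathbf y)$. The artifact set of a set $A\subset\mathbb{R}^n$ is $\mathcal A(A)=\{\hat{\mathbf x}(\mathbf y,\mathbf x):\mathbf y\in\mathbb{R}^n,\ \mathbf x\in A\cap S(\mathbf y)\}$. Reconstruction of distributions supported in an open set $\Omega$ from data $Rf(\mathbf y)$, $\mathbf y\in Y$, is weakly stable at $\mathbf x\in\Omega$ if (1) for every $\omega\in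 S^{n-1}$ there exists $\mathbf y\in Y$ such that $\mathbf x\in S(\mathbf y)$ and $\mathbf x-\mathbf y$ is parallel to $\omega$; and (2) $\mathbf x\notin\mathcal A(\Omega)$. It is weakly stable on $\Omega$ (and one says $R:\mathcal E'(\Omega)\to\mathcal D'(Y)$ is weakly stable) if this holds for every $\mathbf x\in\Omega$. Here $\Omega=D'$ and $Y=Y''$. *)

(* Defs.v *)
From HB Require Import structures.
From mathcomp Require Import all_boot all_order all_algebra.
From mathcomp Require Import all_classical all_reals all_analysis.

Set Implicit Arguments.
Unset Strict Implicit.
Unset Printing Implicit Defensive.

Import Order.TTheory GRing.Theory Num.Theory.
Import numFieldNormedType.Exports.
Local Open Scope classical_set_scope.
Local Open Scope ring_scope.

(** Points of R^n are row vectors ['rV[R]_n].  The library norm [`|x|] on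
    ['rV[R]_n] is the sup norm, so the Euclidean norm is defined here. *)
Definition enorm (R : realType) (n : nat) (x : 'rV[R]_n) : R :=
  Num.sqrt (\sum_(i < n) x 0 i ^+ 2).

Definition unit_sphere (R : realType) (n : nat) : set 'rV[R]_n :=
  [set w | enorm w = 1].

Definition gradient (R : realType) (n : nat) (f : 'rV[R]_n -> R)
    (y : 'rV[R]_n) : 'rV[R]_n :=
  \row_(i < n) 'D_(delta_mx 0 i) f y.

(** The sphere S(y) over which the spherical Radon transform with radius
    function [rad] integrates. *)
Definition sphere (R : realType) (n : nat) (rad : 'rV[R]_n -> R)
    (y : 'rV[R]_n) : set 'rV[R]_n :=
  [set x | enorm (x - y) = rad y].

Definition line_through (R : realType) (n : nat) (p q : 'rV[R]_n) :
    set 'rV[R]_n :=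
  [set z | exists t : R, z = p + t *: (q - p)].

(** Either orientation is allowed: the factor may be negative. *)
Definition parallel (R : realType) (n : nat) (u w : 'rV[R]_n) : Prop :=
  exists c : R, u = c *: w.

(** [z] is the artifact point of [x] with respect to S(y).  When [rad] is
    positive and its gradient has Euclidean norm < 1, the point
    [y - rad y *: gradient rad y] lies strictly inside S(y), so the line meets
    S(y) in exactly two points and [z] is unique. *)
Definition artifact_point (R : realType) (n : nat) (rad : 'rV[R]_n -> R)
    (y x z : 'rV[R]_n) : Prop :=
  [/\ sphere rad y z,
      line_through x (y - rad y *: gradient rad y) z
    & z <> x].

(** The center y ranges over all of R^n, not only over the data set Y. *)
Definition artifact_set (R : realType) (n : nat) (rad : 'rV[R]_n -> R)
    (A : set 'rV[R]_n) : set 'rV[R]_n :=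
  [set z | exists y x : 'rV[R]_n,
     (A `&` sphere rad y) x /\ artifact_point rad y x z].

(** Weak stability at [x] of the reconstruction of distributions supported in
    [Omega] from Rf(y), y in [Y], R being the spherical Radon transform with
    radius function [rad].  The notion is a condition on the spheres of
    integration alone: R enters through [sphere rad], and no particular f
    occurs. *)
Definition weakly_stable_at (R : realType) (n : nat) (rad : 'rV[R]_n -> R)
    (Omega Y : set 'rV[R]_n) (x : 'rV[R]_n) : Prop :=
  (forall w : 'rV[R]_n, unit_sphere w ->
     exists y : 'rV[R]_n, [/\ Y y, sphere rad y x & parallel (x - y) w])
  /\ ~ artifact_set rad Omega x.

Definition weakly_stable (R : realType) (n : nat) (rad : 'rV[R]_n -> R)
    (Omega Y : set 'rV[R]_n) : Prop :=
  forall x : 'rV[R]_n, Omega x -> weakly_stable_at rad Omega Y x.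

Definition annulus (R : realType) (n : nat) (a b : R) : set 'rV[R]_n :=
  [set x | a < enorm x < b].

(* Main.v *)
Require Import Defs.
From HB Require Import structures.
From mathcomp Require Import all_boot all_order all_algebra.
From mathcomp Require Import all_classical all_reals all_analysis.
From mathcomp Require Import ring lra.

Import Order.TTheory GRing.Theory Num.Theory.
Import numFieldNormedType.Exports.
Local Open Scope classical_set_scope.
Local Open Scope ring_scope.

(** Both conditions come from the parallelogram law.  For a unit vector w, the
    squared norms of x + r w and x - r w have sum 2|x|^2 + 2r^2, which lies
    strictly between 2r^2 and 4r^2; so both are below 4r^2 and at least one
    exceeds r^2, and that one is a valid center.  For the second condition,
    artifact points with respect to S(y) are antipodal, hence at distance 2r,
    which is impossible for two points of the open ball of radius r. *)

Lemma enorm_ge0 (R : realType) (n : nat) (x : 'rV[R]_n) : 0 <= enorm x.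
Proof. exact: sqrtr_ge0. Qed.

Lemma enorm_sqr (R : realType) (n : nat) (x : 'rV[R]_n) :
  enorm x ^+ 2 = \sum_(i < n) x 0 i ^+ 2.
Proof. by rewrite sqr_sqrtr // sumr_ge0 // => i _; exact: sqr_ge0. Qed.

Lemma enormZ (R : realType) (n : nat) (a : R) (x : 'rV[R]_n) :
  enorm (a *: x) = `|a| * enorm x.
Proof.
rewrite /enorm -sqrtr_sqr -sqrtrM ?sqr_ge0 // mulr_sumr.
by congr Num.sqrt; apply: eq_bigr => i _; rewrite mxE exprMn.
Qed.

Lemma enorm_parallelogram (R : realType) (n : nat) (x y : 'rV[R]_n) :
  enorm (x + y) ^+ 2 + enorm (x - y) ^+ 2 =
  2 * enorm x ^+ 2 + 2 * enorm y ^+ 2.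
Proof.
rewrite !enorm_sqr !mulr_sumr -!big_split /=.
by apply: eq_bigr => i _; rewrite !mxE; ring.
Qed.

Lemma gradient_cst (R : realType) (n : nat) (a : R) (y : 'rV[R]_n) :
  gradient (fun=> a) y = 0.
Proof. by apply/rowP => i; rewrite !mxE; exact: derive_cst. Qed.

(** For constant radius the gradient vanishes, so the line runs through the center [y] and [z - y]
    is a multiple of [x - y]. Both vectors have length [r > 0], so the factor is 1 or -1; the value
    1 would give [z = x]. *)
Lemma artifact_point_cst (R : realType) (n : nat) (r : R)
    (y x z : 'rV[R]_n) : 0 < r -> sphere (fun=> r) y x ->
  artifact_point (fun=> r) y x z -> z - y = - (x - y).
Proof.
move=> r0 xy [zy [t zE] zx].
have zyE : z - y = (1 - t) *: (x - y).
  by rewrite zE gradient_cst; apply/rowP => i; rewrite !mxE; ring.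
have t1 : `|1 - t| = 1.
  move: zy; rewrite /sphere /= zyE enormZ (xy : enorm (x - y) = r).
  by rewrite -[RHS]mul1r => /(mulIf (lt0r_neq0 r0)).
have /eqP := t1; rewrite eqr_norml ler01 andbT => /orP[] /eqP t1E.
  by case: zx; apply/(addIr (- y)); rewrite zyE t1E scale1r.
by rewrite zyE t1E scaleN1r.
Qed.

Lemma exists_center (R : realType) (n : nat) (r : R) (x w : 'rV[R]_n) :
  0 < enorm x < r -> enorm w = 1 ->
  exists y, [/\ annulus r (2 * r) y, sphere (fun=> r) y x & parallel (x - y) w].
Proof.
move=> /andP[x0 xr] w1; have r0 : 0 < r := lt_trans x0 xr.
have rwE : enorm (r *: w) = r by rewrite enormZ w1 mulr1 gtr0_norm.
have := enorm_parallelogram R n x (r *: w); rewrite rwE => para.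
have p0 := enorm_ge0 R n (x + r *: w); have m0 := enorm_ge0 R n (x - r *: w).
(* Take the candidate farther from the origin: its squared norm is at least half the sum,
   [|x|^2 + r^2 > r^2], and at most the whole sum, which is below [4r^2]. *)
have [pm|mp] := leP (enorm (x - r *: w)) (enorm (x + r *: w)).
- exists (x + r *: w); split.
  + by apply/andP; split; nra.
  + by rewrite /sphere /= opprD addNKr -scaleN1r enormZ normrN1 mul1r.
  + by exists (- r); rewrite opprD addNKr scaleNr.
- exists (x - r *: w); split.
  + by apply/andP; split; nra.
  + by rewrite /sphere /= subKr.
  + by exists r; rewrite subKr.
Qed.

Theorem theorem4p19 (R : realType) (n : nat) (d r : R)
    (hd : 0 < d) (hdr : d < r) :
  weakly_stable (fun _ : 'rV[R]_n => r) (annulus d r) (annulus r (2 * r)).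
Proof.
have r0 : 0 < r := lt_trans hd hdr.
move=> z /andP[dz zr]; split => [w w1|[y [x [[/andP[dx xr] xy] art]]]].
  by apply: exists_center => //; rewrite zr (lt_trans hd dz).
have zyE := artifact_point_cst _ _ _ _ _ _ r0 xy art.
have zxE : z - x = (-2) *: (x - y).
  rewrite -(subrKA y) -[y - x]opprB zyE.
  by apply/rowP => i; rewrite !mxE; ring.
(* Since [|z - x| = 2r], this reads [|z + x|^2 + 4r^2 = 2|z|^2 + 2|x|^2], whose right side is below
   [4r^2]. *)
have := enorm_parallelogram R n z x.
rewrite zxE enormZ (xy : enorm (x - y) = r) normrN (ger0_norm (ler0n _ 2)).
by have := sqr_ge0 (enorm (z + x)); have := enorm_ge0 R n z; nra.
Qed.
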